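(* Every 2EPR-GHZ box has communication value, in the direction $C\to AB$, strictly greater than $0$; in particular $\mathrm{CV}\ge 0.3219$.
   Context: Three parties: Alice ($A$), Bob ($B$), Charlie ($C$). Notation: $|\Psi^+\rangle_{XY}=\frac1{\sqrt2}(|00\rangle+|11\rangle)$ (EPR pair of two qubits), $|GHZ\rangle_{ABC}=\frac1{\sqrt2}(|000\rangle+|111\rangle)$. A tripartite LOCC operation $\Lambda_{ABC}$ is a quantum channel (completely positive trace-preserving map) implemented by Alice, Bob and Charlie by rounds of local quantum operations and classical communication among them, with no pre-shared entanglement. Alice's and Bob's systems are qubits both at input and at output. An LOCC operation is called a 2EPR-GHZ box if Charlie's input system consists of two qubits $C=C_1C_2$ and the input $|\Psi^+\rangle_{AC_1}|\Psi^+\rangle_{BC_2}$ is mapped to the output $|GHZ\rangle_{ABC}$. No requirement is made on the action of the box on other inputs. Communication value (CV) of a box, in the direction $C\to AB$: the maximal asymptotic rate (capacity), in classical bits per use of the box, at which the user Charlie can reliably (with error probability vanishing as the number $n$ of uses tends to infinity) send classical messages to the users Alice and Bob by means of $n$ uses of the box. Here Alice and Bob are regarded as a single party that may perform arbitrary joint quantum operations; the users may consume an arbitrary amount of pre-shared entanglement and use local ancillas, and may feed any (message-independent, shared) input state into the box, with Charlie applying message-dependent local operations on his systems; apart from the box there is no communication between Charlie and Alice–Bob. *)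

(* Defs.v *)
From HB Require Import structures.
From mathcomp Require Import all_boot all_order all_algebra.
From mathcomp Require Import sesquilinear spectral complex.
From mathcomp Require Import all_classical all_reals all_analysis.

Set Implicit Arguments.
Unset Strict Implicit.
Unset Printing Implicit Defensive.

Import Order.TTheory GRing.Theory Num.Theory.

Local Open Scope ring_scope.
Local Open Scope complex_scope.
Local Open Scope sesquilinear_scope.

(* A finite-dimensional system is given by a finType I labelling its
   computational basis; the composite of systems I and J is I * J, and n copies
   of I are {ffun 'I_n -> I}.  Vectors and operators are the library's matrices,
   indexed through the enumeration of I. *)
Notation vec R I := ('cV[R[i]]_(#|{: I%type}|)).
Notation op R I := ('M[R[i]]_(#|{: I%type}|)).

Section Operators.
Variable R : realType.

Definition vget (I : finType) (v : vec R I) (i : I) : R[i] := v (enum_rank i) 0.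

Definition mkvec (I : finType) (f : I -> R[i]) : vec R I :=
  \col_p f (enum_val p).

Definition opget (I : finType) (X : op R I) (i j : I) : R[i] :=
  X (enum_rank i) (enum_rank j).

Definition mkop (I : finType) (f : I -> I -> R[i]) : op R I :=
  \matrix_(p, q) f (enum_val p) (enum_val q).

Definition ket (I : finType) (i : I) : vec R I := delta_mx (enum_rank i) 0.

(* |i><j| *)
Definition ketbra (I : finType) (i j : I) : op R I :=
  delta_mx (enum_rank i) (enum_rank j).

(* |v><v| *)
Definition pure (I : finType) (v : vec R I) : op R I := v *m v ^t*.

(* In the order of R[i], 0 <= z says that z is real and nonnegative, so that
   Hermitian symmetry of X follows. *)
Definition psd (I : finType) (X : op R I) : Prop :=
  forall v : vec R I, 0 <= (v ^t* *m X *m v) 0 0.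

Definition density (I : finType) (X : op R I) : Prop := psd X /\ \tr X = 1.

Definition relabel (I J : finType) (h : J -> I) (X : op R I) : op R J :=
  mkop (fun i j => opget X (h i) (h j)).

(* id_K (x) F, for a linear map F: the (k, l) block of the result is F applied
   to the (k, l) block <k|X|l> of X. *)
Definition ampl (K I J : finType) (F : op R I -> op R J) (X : op R (K * I)) :
    op R (K * J) :=
  mkop (fun p q =>
    opget (F (mkop (fun i j => opget X (p.1, i) (q.1, j)))) p.2 q.2).

Definition ptrace2 (I K : finType) (X : op R (I * K)) : op R I :=
  mkop (fun i j => \sum_(k : K) opget X (i, k) (j, k)).

Definition completely_positive (I J : finType) (F : op R I -> op R J) : Prop :=
  linear F /\
  forall (K : finType) (X : op R (K * I)), psd X -> psd (ampl F X).

Definition channel (I J : finType) (F : op R I -> op R J) : Prop :=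
  completely_positive F /\ forall X, \tr (F X) = \tr X.

(* A general quantum operation with classical outcome o : O; the output system
   may depend on the outcome. *)
Definition instrument (I O : finType) (J : O -> finType)
    (E : forall o, op R I -> op R (J o)) : Prop :=
  (forall o, completely_positive (E o)) /\
  forall X, \sum_o \tr (E o X) = \tr X.

Definition povm (I O : finType) (D : O -> op R I) : Prop :=
  (forall o, psd (D o)) /\ \sum_o D o = 1%:M.

End Operators.

Section LOCC.
Variable R : realType.

Definition on_Alice (A B C A1 : finType) (E : op R A -> op R A1)
    (X : op R ((A * B) * C)) : op R ((A1 * B) * C) :=
  relabel (fun x : (A1 * B) * C => ((x.1.2, x.2), x.1.1))
    (ampl E (relabel (fun y : (B * C) * A => ((y.2, y.1.1), y.1.2)) X)).

Definition on_Bob (A B C B1 : finType) (E : op R B -> op R B1)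
    (X : op R ((A * B) * C)) : op R ((A * B1) * C) :=
  relabel (fun x : (A * B1) * C => ((x.1.1, x.2), x.1.2))
    (ampl E (relabel (fun y : (A * C) * B => ((y.1.1, y.2), y.1.2)) X)).

Definition on_Charlie (A B C C1 : finType) (E : op R C -> op R C1)
    (X : op R ((A * B) * C)) : op R ((A * B) * C1) :=
  ampl E X.

(* In each round one party applies an instrument to its system and broadcasts
   the outcome o, and the continuation may depend on o.  Summing over o forgets
   the transcript at the end. *)
Inductive locc (A' B' C' : finType) :
  forall A B C : finType,
    (op R ((A * B) * C) -> op R ((A' * B') * C')) -> Prop :=
| locc_done : locc (fun X : op R ((A' * B') * C') => X)
| locc_Alice (A B C O : finType) (A1 : O -> finType)
    (E : forall o, op R A -> op R (A1 o))
    (F : forall o, op R ((A1 o * B) * C) -> op R ((A' * B') * C')) :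
    instrument E -> (forall o, locc (F o)) ->
    locc (fun X : op R ((A * B) * C) => \sum_o F o (on_Alice (E o) X))
| locc_Bob (A B C O : finType) (B1 : O -> finType)
    (E : forall o, op R B -> op R (B1 o))
    (F : forall o, op R ((A * B1 o) * C) -> op R ((A' * B') * C')) :
    instrument E -> (forall o, locc (F o)) ->
    locc (fun X : op R ((A * B) * C) => \sum_o F o (on_Bob (E o) X))
| locc_Charlie (A B C O : finType) (C1 : O -> finType)
    (E : forall o, op R C -> op R (C1 o))
    (F : forall o, op R ((A * B) * C1 o) -> op R ((A' * B') * C')) :
    instrument E -> (forall o, locc (F o)) ->
    locc (fun X : op R ((A * B) * C) => \sum_o F o (on_Charlie (E o) X)).

Definition EPR : vec R ('I_2 * 'I_2) :=
  (sqrtC 2)^-1 *: (ket R (0, 0) + ket R (1, 1)).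

Definition EPR_AC1_EPR_BC2 : vec R (('I_2 * 'I_2) * ('I_2 * 'I_2)) :=
  mkvec (fun x => let: ((a, b), (c1, c2)) := x in
                  vget EPR (a, c1) * vget EPR (b, c2)).

Definition GHZ : vec R (('I_2 * 'I_2) * 'I_2) :=
  (sqrtC 2)^-1 *: (ket R ((0, 0), 0) + ket R ((1, 1), 1)).

Definition is_2EPR_GHZ_box
    (L : op R (('I_2 * 'I_2) * ('I_2 * 'I_2)) -> op R (('I_2 * 'I_2) * 'I_2)) :
    Prop :=
  locc L /\ L (pure EPR_AC1_EPR_BC2) = pure GHZ.

End LOCC.

(* S is the joint system of Alice and Bob (regarded as one party), T that of
   Charlie; primes mark the outputs of the box L. *)
Section CommunicationValue.
Variables (R : realType) (S T S' T' : finType).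
Variable L : op R (S * T) -> op R (S' * T').

(* The n-fold tensor power of a linear map L, with the n systems of each side
   grouped together. *)
Definition boxes (n : nat)
    (X : op R ({ffun 'I_n -> S} * {ffun 'I_n -> T})) :
    op R ({ffun 'I_n -> S'} * {ffun 'I_n -> T'}) :=
  mkop (fun k l : {ffun 'I_n -> S'} * {ffun 'I_n -> T'} =>
    \sum_(i : {ffun 'I_n -> S} * {ffun 'I_n -> T})
    \sum_(j : {ffun 'I_n -> S} * {ffun 'I_n -> T}) opget X i j *
    \prod_(t < n) opget (L (ketbra R (i.1 t, i.2 t) (j.1 t, j.2 t)))
                        (k.1 t, k.2 t) (l.1 t, l.2 t)).

(* A block code for n parallel uses and m messages.  memAB is whatever Alice and
   Bob keep besides their box inputs; memC is all that Charlie holds (his share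
   of the entanglement, ancillas, prepared box inputs), which he maps to the n
   box inputs by a message-dependent channel.  What he keeps and his box outputs
   never reach Alice and Bob, so they are traced out. *)
Record cv_code (n m : nat) := CVCode {
  memAB : finType;
  memC : finType;
  shared : op R (memAB * ({ffun 'I_n -> S} * memC));
  encoder : 'I_m -> op R memC -> op R {ffun 'I_n -> T};
  decoder : 'I_m -> op R (memAB * {ffun 'I_n -> S'});
  sharedP : density shared;
  encoderP : forall x, channel (encoder x);
  decoderP : povm decoder }.
#[global] Arguments shared {n m} c.
#[global] Arguments encoder {n m} c x _.
#[global] Arguments decoder {n m} c x.

Definition received (n m : nat) (c : cv_code n m) (x : 'I_m) :
    op R (memAB c * {ffun 'I_n -> S'}) :=
  ampl (fun X : op R ({ffun 'I_n -> S} * memC c) =>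
          ptrace2 (boxes (ampl (encoder c x) X)))
    (shared c).

Definition success_prob (n m : nat) (c : cv_code n m) (x : 'I_m) : R[i] :=
  \tr (decoder c x *m received c x).

(* Rate in bits per use, with vanishing maximal error probability. *)
Definition achievable (r : R) : Prop :=
  0 <= r /\
  forall eps : R, 0 < eps ->
    exists n0 : nat, forall n : nat, (n0 <= n)%N ->
      exists (m : nat) (c : cv_code n m),
        2 `^ (n%:R * r) <= m%:R /\
        forall x : 'I_m, (1 - eps)%:C <= success_prob c x.

(* An extended real, hence meaningful without a boundedness proof. *)
Definition CV : \bar R := ereal_sup [set r%:E | r in achievable].

End CommunicationValue.

(* Main.v *)
Require Import Defs.
From mathcomp Require Import all_boot all_order all_algebra.
From mathcomp Require Import sesquilinear spectral complex.
From mathcomp Require Import all_classical all_reals all_analysis.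
From mathcomp Require Import zify ring lra.

(* An LOCC map has product Kraus operators a (x) b (x) c.  If it sends the two EPR
   pairs to GHZ, each Kraus operator sends them to a multiple of GHZ, that is
   a c_z b^T is a multiple of E_zz for both values z of Charlie's output.  This
   determines c_z from a and b, and Hadamard's inequality |det a|^2 <= x_0 x_1
   (x_i the squared row norms of a) then shows that on the maximally mixed input
   Alice's and Bob's outputs agree with probability at least 1/2 and differ with
   probability at least 1/2, hence exactly 1/2 each, whereas on the EPR pairs they
   always agree.  The reduced state of Alice and Bob is the same for both inputs, so
   Charlie can select the input by a local operation: feeding in either his halves
   of the EPR pairs or a maximally mixed state, he gets a Z-channel with crossover
   probability 1/2, of capacity log2 (5/4) = 0.32192...  Feinstein's maximal code
   argument at the optimal input distribution (3/5, 2/5) achieves every smaller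
   rate. *)

Set Implicit Arguments.
Unset Strict Implicit.
Unset Printing Implicit Defensive.

Import Order.TTheory GRing.Theory Num.Theory.

Local Open Scope ring_scope.
Local Open Scope sesquilinear_scope.

(** * Positive operators and Kraus decompositions of completely positive maps *)

Section Kraus.
Variable R : realType.
Implicit Types I J K : finType.

Lemma opgetE I (f : I -> I -> R[i]) i j : opget (mkop f) i j = f i j.
Proof. by rewrite /opget mxE !enum_rankK. Qed.

Lemma op_ext I (X Y : op R I) :
  (forall i j, opget X i j = opget Y i j) -> X = Y.
Proof.
move=> XY; apply/matrixP => p q.
by have := XY (enum_val p) (enum_val q); rewrite /opget !enum_valK.
Qed.

Lemma opgetD I (X Y : op R I) i j : opget (X + Y) i j = opget X i j + opget Y i j.
Proof. by rewrite /opget mxE. Qed.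

Lemma opgetZ I c (X : op R I) i j : opget (c *: X) i j = c * opget X i j.
Proof. by rewrite /opget mxE. Qed.

Lemma opget_sum I (O : Type) (s : seq O) (P : pred O) (X : O -> op R I) i j :
  opget (\sum_(o <- s | P o) X o) i j = \sum_(o <- s | P o) opget (X o) i j.
Proof. by rewrite /opget summxE. Qed.

Lemma sum_enum_val I (f : 'I_#|I| -> R[i]) :
  \sum_p f p = \sum_(i : I) f (enum_rank i).
Proof. by rewrite (reindex enum_rank) //; apply/onW_bij/enum_rank_bij. Qed.

Lemma opget_tr I (X : op R I) : \tr X = \sum_i opget X i i.
Proof. by rewrite /mxtrace sum_enum_val. Qed.

Lemma psdE I (X : op R I) :
  psd X <-> forall f : I -> R[i],
    0 <= \sum_i \sum_j Num.conj (f i) * opget X i j * f j.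
Proof.
have qE (v : vec R I) : ((v ^t*) *m X *m v) 0 0 =
    \sum_i \sum_j Num.conj (vget v i) * opget X i j * vget v j.
  rewrite mxE sum_enum_val exchange_big /=; apply: eq_bigr => j _.
  rewrite mxE sum_enum_val mulr_suml; apply: eq_bigr => i _.
  by rewrite !mxE.
split=> [psdX f|psdX v]; last by rewrite qE.
have := psdX (mkvec f); rewrite qE.
by under eq_bigr do under eq_bigr do rewrite /vget !mxE !enum_rankK.
Qed.

Lemma mulmx_delta (C : pzSemiRingType) m n (X : 'M[C]_(m, n)) i j :
  (@delta_mx C 1 m 0 i *m X *m @delta_mx C n 1 j 0) 0 0 = X i j.
Proof. by rewrite -colE -rowE !mxE. Qed.

(** Polarization: the form at [delta_mx i 0 + c *: delta_mx j 0] is real for every [c], and the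
    cases [c = 1] and [c = 'i] together determine [X i j] as the conjugate of [X j i]. *)
Lemma psd_hermitian n (X : 'M[R[i]]_n) :
  (forall v : 'cV_n, 0 <= ((v ^t*) *m X *m v) 0 0) -> X ^t* = X.
Proof.
move=> psdX.
have D (A B : 'M[R[i]]_(1, 1)) : (A + B) 0 0 = A 0 0 + B 0 0 by rewrite mxE.
have Z c (A : 'M[R[i]]_(1, 1)) : (c *: A) 0 0 = c * A 0 0 by rewrite mxE.
have qE i j c : 0 <= X i i + c * X i j + (Num.conj c * X j i + Num.conj c * c * X j j).
  have := psdX (delta_mx i 0 + c *: delta_mx j 0).
  have -> : (delta_mx i 0 + c *: delta_mx j 0 : 'cV_n) ^t* =
      delta_mx 0 i + Num.conj c *: delta_mx 0 j.
    apply/matrixP => k l; rewrite !mxE rmorphD rmorphM /= !conjC_nat.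
    by rewrite ![(k == 0) && _]andbC.
  rewrite !(mulmxDl, mulmxDr) -!(scalemxAl, scalemxAr) !D !Z !mulmx_delta.
  by congr (_ <= _); ring.
have qR i j c : c * X i j + Num.conj c * X j i =
    Num.conj c * Num.conj (X i j) + c * Num.conj (X j i).
  have dR k : Num.conj (X k k) = X k k.
    by apply/CrealP; have := qE k k 0; rewrite conjC0 !mul0r !addr0; exact: ger0_real.
  have /ger0_real/CrealP := qE i j c.
  rewrite !(rmorphD, rmorphM) /= !conjCK !dR => E.
  apply: (addrI (X i i + Num.conj c * c * X j j)).
  transitivity (X i i + c * X i j +
    (Num.conj c * X j i + Num.conj c * c * X j j)); first by ring.
  by rewrite -E; ring.
apply/matrixP => i j; rewrite !mxE.
have E1 := qR i j 1; have E2 := qR i j 'i.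
rewrite conjC1 !mul1r in E1; rewrite conjCi !mulNr -!mulrBr in E2.
rewrite [RHS]addrC -mulrBr in E2.
move/(mulfI (neq0Ci _)): E2 => E2.
have E : 2%:R * X i j = 2%:R * Num.conj (X j i).
  transitivity ((X i j + X j i) + (X i j - X j i)); first by ring.
  by rewrite E1 E2; ring.
by apply/esym/(mulfI _ E); rewrite pnatr_eq0.
Qed.

(** Spectral theorem: the vectors are the eigenvectors, scaled by the square roots of the
    eigenvalues. *)
Lemma psd_sum_pure I (X : op R I) : psd X ->
  exists s : seq (I -> R[i]),
    forall i j, opget X i j = \sum_(v <- s) v i * Num.conj (v j).
Proof.
move=> psdX; have hX := psd_hermitian psdX.
have Xherm : X \is hermsymmx by rewrite is_hermitianmxE expr0 scale1r; apply/eqP.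
have /orthomx_spectralP := hermitian_normalmx Xherm.
set P := spectralmx X; set d := spectral_diag X.
have Pu : P \is unitarymx := spectral_unitarymx X.
rewrite invmx_unitary // => XE.
(* An eigenvalue is the value of the form at its unit eigenvector, the k-th column of the adjoint of
   [P]. *)
have d_ge0 k : 0 <= d 0 k.
  have := psdX ((P ^t*) *m delta_mx k 0).
  rewrite trmx_mul map_mxM /= trmxCK XE !mulmxA.
  move: (Pu) => /unitarymxP PP; rewrite -!mulmxA (mulmxA P) PP mul1mx.
  rewrite (mulmxA P) PP mul1mx trmx_delta map_delta_mx -colE -rowE !mxE.
  by rewrite eqxx mulr1n.
exists [seq (fun i => sqrtC (d 0 k) * Num.conj (P k (enum_rank i))) | k <- enum 'I_#|I|].
move=> i j; rewrite big_map big_enum /= {1}/opget {1}XE mxE.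
apply: eq_bigr => k _; rewrite mul_mx_diag !mxE rmorphM /= conjCK.
have /conj_Creal -> : sqrtC (d 0 k) \is Num.real by rewrite ger0_real // sqrtC_ge0.
by rewrite -{1}(sqrtCK (d 0 k)) expr2; ring.
Qed.

(** Conjugation of [X] by [K]. Kraus operators are functions of basis labels, so that tensor factors
    can be split off without passing through the enumeration. *)
Definition kact I J (K : J -> I -> R[i]) (X : op R I) : op R J :=
  mkop (fun p q => \sum_i \sum_j K p i * opget X i j * Num.conj (K q j)).

Lemma opget_ketbra I (i j k l : I) :
  opget (ketbra R i j) k l = (k == i)%:R * (l == j)%:R.
Proof. by rewrite /opget mxE !(inj_eq enum_rank_inj) -natrM mulnb. Qed.

Lemma op_sum_ketbra I (X : op R I) :
  X = \sum_i \sum_j opget X i j *: ketbra R i j.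
Proof.
apply: op_ext => k l; rewrite opget_sum (bigD1 k) //= opget_sum (bigD1 l) //=.
rewrite opgetZ opget_ketbra !eqxx !mulr1 !big1 ?addr0 //.
  by move=> i /negbTE ik; rewrite opget_sum big1 // => j _;
    rewrite opgetZ opget_ketbra eq_sym ik mul0r mulr0.
by move=> j /negbTE jl; rewrite opgetZ opget_ketbra [l == _]eq_sym jl !mulr0.
Qed.

Lemma linear_ketbra I J (F : op R I -> op R J) (X : op R I) : linear F ->
  F X = \sum_i \sum_j opget X i j *: F (ketbra R i j).
Proof.
move=> linF.
have F0 : F 0 = 0 by have := linF (-1) 0 0; rewrite scaler0 addr0 scaleN1r addNr.
have FD A B : F (A + B) = F A + F B by have := linF 1 A B; rewrite !scale1r.
have FZ c A : F (c *: A) = c *: F A by have := linF c A 0; rewrite F0 !addr0.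
rewrite {1}[X]op_sum_ketbra (big_morph F FD F0); apply: eq_bigr => i _.
by rewrite (big_morph F FD F0); apply: eq_bigr => j _; rewrite FZ.
Qed.

(* The Choi operator of F is F amplified at the unnormalized maximally entangled
   state; each pure summand of it is a Kraus operator. *)
Lemma completely_positive_kraus I J (F : op R I -> op R J) :
  completely_positive F ->
  exists s : seq (J -> I -> R[i]), forall X, F X = \sum_(K <- s) kact K X.
Proof.
case=> linF cpF.
pose Om : op R (I * I) := mkop (fun p q => (p.1 == p.2)%:R * (q.1 == q.2)%:R).
have psdOm : psd Om.
  apply/psdE => f.
  have -> : \sum_i \sum_j Num.conj (f i) * opget Om i j * f j =
      Num.conj (\sum_i (i.1 == i.2)%:R * f i) * (\sum_i (i.1 == i.2)%:R * f i).
    rewrite rmorph_sum mulr_suml; apply: eq_bigr => i _.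
    rewrite mulr_sumr; apply: eq_bigr => j _.
    by rewrite opgetE rmorphM /= conjC_nat; ring.
  by rewrite mulrC mul_conjC_ge0.
have [s sE] := psd_sum_pure (cpF _ _ psdOm).
exists [seq (fun k i => v (i, k)) | v <- s] => X.
rewrite (linear_ketbra _ linF) big_map; apply: op_ext => k l.
rewrite !opget_sum.
under [RHS]eq_bigr do rewrite opgetE.
rewrite [RHS]exchange_big /=; apply: eq_bigr => i _.
rewrite [RHS]exchange_big opget_sum /=; apply: eq_bigr => j _.
rewrite opgetZ.
(* The block (i, j) of the Choi operator is [F] at the matrix unit of (i, j). *)
have -> : opget (F (ketbra R i j)) k l = \sum_(v <- s) v (i, k) * Num.conj (v (j, l)).
  rewrite -sE opgetE /=; congr opget; congr F; apply: op_ext => a b.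
  by rewrite !opgetE opget_ketbra /= (eq_sym a) (eq_sym b).
by rewrite mulr_sumr; apply: eq_bigr => v _; ring.
Qed.

End Kraus.

(** * LOCC maps have product Kraus operators and preserve the trace *)

Section Separable.
Variable R : realType.

Lemma kact_sum (I J : finType) (K : J -> I -> R[i]) (T : Type) (s : seq T)
    (X : T -> op R I) :
  kact K (\sum_(t <- s) X t) = \sum_(t <- s) kact K (X t).
Proof.
apply: op_ext => p q; rewrite opget_sum opgetE.
under [RHS]eq_bigr do rewrite opgetE.
rewrite [RHS]exchange_big /=; apply: eq_bigr => i _.
rewrite [RHS]exchange_big /=; apply: eq_bigr => j _.
by rewrite opget_sum mulr_sumr mulr_suml.
Qed.

Definition kcomp (I J H : finType) (K : J -> I -> R[i]) (K' : I -> H -> R[i])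
    (p : J) (h : H) : R[i] := \sum_i K p i * K' i h.

Lemma kact_comp (I J H : finType) (K : J -> I -> R[i]) (K' : I -> H -> R[i]) X :
  kact K (kact K' X) = kact (kcomp K K') X.
Proof.
apply: op_ext => p q; rewrite !opgetE.
transitivity (\sum_i \sum_j \sum_g \sum_h
   K p i * K' i g * opget X g h * Num.conj (K q j * K' j h)).
  apply: eq_bigr => i _; apply: eq_bigr => j _.
  rewrite opgetE mulr_sumr mulr_suml; apply: eq_bigr => g _.
  rewrite mulr_sumr mulr_suml; apply: eq_bigr => h _.
  by rewrite rmorphM /=; ring.
under eq_bigr do rewrite exchange_big /=.
rewrite exchange_big /=; apply: eq_bigr => g _.
under eq_bigr do rewrite exchange_big /=.
rewrite exchange_big /=; apply: eq_bigr => h _.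
rewrite /kcomp rmorph_sum !mulr_suml; apply: eq_bigr => i _.
by rewrite mulr_sumr; apply: eq_bigr => j _.
Qed.

(** Serves operators that act on one tensor factor: [h p a] is the composite input with local label
    [a] and the other labels copied from [p], so only the local labels remain summed. *)
Lemma kact_embed (I J A : finType) (K : J -> I -> R[i]) (k : J -> A -> R[i])
    (h : J -> A -> I) (X : op R I) p q :
  (forall p i, K p i = \sum_a k p a * (i == h p a)%:R) ->
  opget (kact K X) p q =
    \sum_a \sum_b k p a * opget X (h p a) (h q b) * Num.conj (k q b).
Proof.
move=> KE; rewrite opgetE.
transitivity (\sum_i \sum_j \sum_a \sum_b (i == h p a)%:R * ((j == h q b)%:R *
   (k p a * opget X i j * Num.conj (k q b)))).
  apply: eq_bigr => i _; apply: eq_bigr => j _.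
  rewrite !KE !mulr_suml; apply: eq_bigr => a _.
  rewrite rmorph_sum mulr_sumr; apply: eq_bigr => b _.
  by rewrite rmorphM /= conjC_nat; ring.
have pick (H : finType) (g : H) (f : H -> R[i]) : \sum_i (i == g)%:R * f i = f g.
  rewrite (bigD1 g) //= eqxx mul1r big1 ?addr0 // => i /negbTE ->.
  by rewrite mul0r.
under eq_bigr do rewrite exchange_big /=.
rewrite exchange_big /=; apply: eq_bigr => a _.
under eq_bigr do under eq_bigr do rewrite -mulr_sumr.
under eq_bigr do rewrite -mulr_sumr.
rewrite pick.
rewrite exchange_big /=; apply: eq_bigr => b _.
by rewrite pick.
Qed.

Definition prodK (A B C A' B' C' : finType)
    (k : (A' -> A -> R[i]) * (B' -> B -> R[i]) * (C' -> C -> R[i]))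
    (p : (A' * B') * C') (i : (A * B) * C) : R[i] :=
  k.1.1 p.1.1 i.1.1 * k.1.2 p.1.2 i.1.2 * k.2 p.2 i.2.

(** Trace preservation is left out so that the single branches of a protocol qualify too;
    [locc_trace] deals with the trace. *)
Definition separable (A B C A' B' C' : finType)
    (L : op R ((A * B) * C) -> op R ((A' * B') * C')) : Prop :=
  exists s : seq ((A' -> A -> R[i]) * (B' -> B -> R[i]) * (C' -> C -> R[i])),
    forall X, L X = \sum_(k <- s) kact (prodK k) X.

Lemma separable_sum (A B C A' B' C' O : finType)
    (L : O -> op R ((A * B) * C) -> op R ((A' * B') * C')) :
  (forall o, separable (L o)) -> separable (fun X => \sum_o L o X).
Proof.
move=> /choice[s sE]; exists (flatten [seq s o | o <- enum O]) => X.
rewrite big_flatten big_map big_enum /=.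
by apply: eq_bigr => o _; rewrite sE.
Qed.

(** Product operators compose factor by factor. *)
Lemma separable_comp (A B C A' B' C' A1 B1 C1 : finType)
    (L : op R ((A1 * B1) * C1) -> op R ((A' * B') * C'))
    (L1 : op R ((A * B) * C) -> op R ((A1 * B1) * C1)) :
  separable L -> separable L1 -> separable (fun X => L (L1 X)).
Proof.
move=> [s sE] [s1 s1E].
exists [seq (kcomp k.1.1 l.1.1, kcomp k.1.2 l.1.2, kcomp k.2 l.2)
       | k <- s, l <- s1] => X.
rewrite sE s1E big_allpairs_dep; apply: eq_bigr => k _.
rewrite kact_sum; apply: eq_bigr => l _.
rewrite kact_comp; congr (kact _ X); apply/funext => p; apply/funext => i.
rewrite /prodK /kcomp /=.
rewrite -(pair_bigA _ (fun x c => k.1.1 p.1.1 x.1 * k.1.2 p.1.2 x.2 * k.2 p.2 c *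
   (l.1.1 x.1 i.1.1 * l.1.2 x.2 i.1.2 * l.2 c i.2))) /=.
rewrite -(pair_bigA _ (fun a b => \sum_c k.1.1 p.1.1 a * k.1.2 p.1.2 b * k.2 p.2 c *
   (l.1.1 a i.1.1 * l.1.2 b i.1.2 * l.2 c i.2))) /=.
rewrite !mulr_suml; apply: eq_bigr => a _.
rewrite -mulrA mulr_suml mulr_sumr; apply: eq_bigr => b _.
by rewrite mulrA mulr_sumr; apply: eq_bigr => c _; ring.
Qed.

Definition idK (I : finType) (p i : I) : R[i] := (i == p)%:R.

Lemma sum_idK (A : finType) (f : A -> R[i]) a : \sum_b f b * (a == b)%:R = f a.
Proof.
rewrite (bigD1 a) //= eqxx mulr1 big1 ?addr0 // => b /negbTE.
by rewrite eq_sym => ->; rewrite mulr0.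
Qed.

(** The Kraus operators of [E] are padded with identities on the other two parties; likewise for Bob
    and Charlie below. *)
Lemma separable_Alice (A B C A1 : finType) (E : op R A -> op R A1) :
  completely_positive E -> separable (@on_Alice R A B C A1 E).
Proof.
move=> /completely_positive_kraus[s sE].
exists [seq (k, @idK B, @idK C) | k <- s] => X.
rewrite big_map; apply: op_ext => p q; rewrite opgetE opgetE /= sE !opget_sum.
apply: eq_bigr => k _.
rewrite (kact_embed (k := fun p => k p.1.1) (h := fun p a => ((a, p.1.2), p.2))).
  by rewrite opgetE; apply: eq_bigr => i _; apply: eq_bigr => j _; rewrite !opgetE.
move=> {}p [[a b] c]; rewrite /prodK /idK /=.
rewrite -mulrA -[k _ a]sum_idK mulr_suml; apply: eq_bigr => a' _.
by rewrite !xpair_eqE -mulrA -!natrM !mulnb andbA.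
Qed.

Lemma separable_Bob (A B C B1 : finType) (E : op R B -> op R B1) :
  completely_positive E -> separable (@on_Bob R A B C B1 E).
Proof.
move=> /completely_positive_kraus[s sE].
exists [seq (@idK A, k, @idK C) | k <- s] => X.
rewrite big_map; apply: op_ext => p q; rewrite opgetE opgetE /= sE !opget_sum.
apply: eq_bigr => k _.
rewrite (kact_embed (k := fun p => k p.1.2) (h := fun p b => ((p.1.1, b), p.2))).
  by rewrite opgetE; apply: eq_bigr => i _; apply: eq_bigr => j _; rewrite !opgetE.
move=> {}p [[a b] c]; rewrite /prodK /idK /=.
rewrite mulrAC mulrC -[k _ b]sum_idK mulr_suml; apply: eq_bigr => b' _.
by rewrite !xpair_eqE -mulrA -!natrM !mulnb andbCA andbA.
Qed.

Lemma separable_Charlie (A B C C1 : finType) (E : op R C -> op R C1) :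
  completely_positive E -> separable (@on_Charlie R A B C C1 E).
Proof.
move=> /completely_positive_kraus[s sE].
exists [seq (@idK A, @idK B, k) | k <- s] => X.
rewrite big_map; apply: op_ext => p q; rewrite opgetE /= sE !opget_sum.
apply: eq_bigr => k _.
rewrite (kact_embed (k := fun p => k p.2) (h := fun p c => (p.1, c))).
  by rewrite opgetE; apply: eq_bigr => i _; apply: eq_bigr => j _; rewrite !opgetE.
move=> {}p [[a b] c]; rewrite /prodK /idK /=.
rewrite mulrC -[k _ c]sum_idK mulr_suml; apply: eq_bigr => c' _.
by case: p => [[pa pb] pc]; rewrite !xpair_eqE -mulrA -!natrM !mulnb /= andbC.
Qed.

Lemma separable_id (A B C : finType) : separable (fun X : op R ((A * B) * C) => X).
Proof.
exists [:: (@idK A, @idK B, @idK C)] => X; rewrite big_seq1.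
apply: op_ext => p q.
rewrite (kact_embed (A := unit) (k := fun _ _ => 1) (h := fun p _ => p)).
  by rewrite !(big_pred1 tt) ?mul1r ?conjC1 ?mulr1 //; case.
move=> {p q} [[pa pb] pc] [[a b] c].
rewrite (big_pred1 tt); last by case.
by rewrite /prodK /idK /= !xpair_eqE mul1r -!natrM !mulnb.
Qed.

Lemma locc_separable (A B C A' B' C' : finType)
    (L : op R ((A * B) * C) -> op R ((A' * B') * C')) : locc L -> separable L.
Proof.
elim=> {A B C L} [|A B C O A1 E F [cpE _] _ IH|A B C O B1 E F [cpE _] _ IH
                  |A B C O C1 E F [cpE _] _ IH]; first exact: separable_id.
- apply: separable_sum => o.
  exact: separable_comp (IH o) (separable_Alice _ _ (cpE o)).
- apply: separable_sum => o.
  exact: separable_comp (IH o) (separable_Bob _ _ (cpE o)).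
- apply: separable_sum => o.
  exact: separable_comp (IH o) (separable_Charlie _ _ (cpE o)).
Qed.

Lemma tr_relabel (I J : finType) (h : J -> I) (X : op R I) :
  bijective h -> \tr (relabel h X) = \tr X.
Proof.
move=> bijh; rewrite !opget_tr (reindex h) /=; last exact: onW_bij.
by apply: eq_bigr => i _; rewrite opgetE.
Qed.

Lemma tr_pair (K I : finType) (X : op R (K * I)) :
  \tr X = \sum_k \sum_i opget X (k, i) (k, i).
Proof. by rewrite opget_tr pair_bigA; apply: eq_bigr => -[]. Qed.

Lemma tr_ampl_instrument (K I O : finType) (J : O -> finType)
    (E : forall o, op R I -> op R (J o)) (X : op R (K * I)) :
  instrument E -> \sum_o \tr (ampl (E o) X) = \tr X.
Proof.
case=> _ trE.
transitivity (\sum_(k : K) \sum_o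
   \tr (E o (mkop (fun i j => opget X (k, i) (k, j))))).
  rewrite exchange_big /=; apply: eq_bigr => o _.
  rewrite tr_pair; apply: eq_bigr => k _.
  by rewrite opget_tr; apply: eq_bigr => j _; rewrite opgetE.
under eq_bigr do rewrite trE opget_tr.
rewrite tr_pair.
by apply: eq_bigr => k _; apply: eq_bigr => j _; rewrite opgetE.
Qed.

(** A single outcome may lose trace, so the induction carries the sum over the outcomes of each
    round. For Alice and Bob, a relabelling first moves the acting party to the last factor, where
    [ampl] acts. *)
Lemma locc_trace (A B C A' B' C' : finType)
    (L : op R ((A * B) * C) -> op R ((A' * B') * C')) X : locc L -> \tr (L X) = \tr X.
Proof.
move=> loccL; elim: loccL X => {A B C L} [//|A B C O A1 E F insE _ IH X
   |A B C O B1 E F insE _ IH X|A B C O C1 E F insE _ IH X];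
  rewrite linear_sum /=; under eq_bigr do rewrite IH.
- rewrite -(tr_relabel (h := fun y => ((y.2, y.1.1), y.1.2)) X); last first.
    by exists (fun y => ((y.1.2, y.2), y.1.1)) => -[[? ?] ?].
  rewrite -(tr_ampl_instrument _ insE); apply: eq_bigr => o _; apply: tr_relabel.
  by exists (fun y => ((y.2, y.1.1), y.1.2)) => -[[? ?] ?].
- rewrite -(tr_relabel (h := fun y => ((y.1.1, y.2), y.1.2)) X); last first.
    by exists (fun y => ((y.1.1, y.2), y.1.2)) => -[[? ?] ?].
  rewrite -(tr_ampl_instrument _ insE); apply: eq_bigr => o _; apply: tr_relabel.
  by exists (fun y => ((y.1.1, y.2), y.1.2)) => -[[? ?] ?].
- exact: tr_ampl_instrument.
Qed.

End Separable.

(** * Inequalities for a single Kraus operator of the box *)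

Section Box.
Variable R : realType.
Local Notation C := R[i].
Implicit Types a b : 'I_2 -> 'I_2 -> C.

Lemma sum_I2 (V : nmodType) (f : 'I_2 -> V) : \sum_i f i = f 0 + f 1.
Proof.
by rewrite big_ord_recl big_ord_recl big_ord0 addr0; congr (_ + f _); apply/val_inj.
Qed.

Lemma forall_I2 (P : 'I_2 -> Prop) : P 0 -> P 1 -> forall i, P i.
Proof.
move=> P0 P1 [[|[|//]] lti]; first by have -> : Ordinal lti = 0 by apply/val_inj.
by have -> : Ordinal lti = 1 by apply/val_inj.
Qed.

Definition det2 a : C := a 0 0 * a 1 1 - a 0 1 * a 1 0.

(** The adjugate matrix; [1 - i] is the other index, since arithmetic in ['I_2] is modulo 2. *)
Definition adj2 a (i j : 'I_2) : C :=
  if i == j then a (1 - i) (1 - i) else - a i j.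

Definition rowsq a (i : 'I_2) : C := \sum_j `|a i j| ^+ 2.

Lemma rowsq_ge0 a i : 0 <= rowsq a i.
Proof. by apply: sumr_ge0 => j _; rewrite exprn_ge0. Qed.

Lemma rowsq_eq0 a i j : rowsq a i = 0 -> a i j = 0.
Proof.
move/eqP; rewrite psumr_eq0 => [/allP/(_ j)|k _]; last by rewrite exprn_ge0.
by rewrite mem_index_enum expf_eq0 normr_eq0 /= => /(_ isT)/eqP.
Qed.

(** Hadamard's inequality, from Lagrange's identity: the defect is the squared modulus of the inner
    product [z] of the two rows. *)
Lemma det2_le a : `|det2 a| ^+ 2 <= rowsq a 0 * rowsq a 1.
Proof.
rewrite /rowsq !sum_I2 -subr_ge0.
set z := a 0 0 * Num.conj (a 1 0) + a 0 1 * Num.conj (a 1 1).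
suff -> : (`|a 0 0| ^+ 2 + `|a 0 1| ^+ 2) * (`|a 1 0| ^+ 2 + `|a 1 1| ^+ 2) -
    `|det2 a| ^+ 2 = `|z| ^+ 2 by rewrite exprn_ge0.
by rewrite !normCK /z /det2 !(rmorphD, rmorphB, rmorphN, rmorphM) /= !conjCK; ring.
Qed.

(** A square in [R[i]] is nonnegative only when its base is real, which the signs of [x] and [y]
    ensure here. *)
Lemma sqrB_ge0 (x y : C) : 0 <= x -> 0 <= y -> 0 <= (x - y) ^+ 2.
Proof.
by move=> x0 y0; apply: real_exprn_even_ge0 => //; rewrite realB // ger0_real.
Qed.

(** This bound will serve the event that Alice's and Bob's outputs differ, [sqr_sum_ge] the event
    that they agree. *)
Lemma mul_sums_ge (x0 x1 u0 u1 : C) : 0 <= x0 -> 0 <= x1 -> 0 <= u0 -> 0 <= u1 ->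
  4%:R * (x0 * x1 * (u0 * u1)) <= (x0 * u0 + x1 * u1) * (x0 * u1 + x1 * u0).
Proof.
move=> x0p x1p u0p u1p; rewrite -subr_ge0.
have -> : (x0 * u0 + x1 * u1) * (x0 * u1 + x1 * u0) - 4%:R * (x0 * x1 * (u0 * u1)) =
   u0 * u1 * (x0 - x1) ^+ 2 + x0 * x1 * (u0 - u1) ^+ 2 by ring.
by rewrite addr_ge0 // mulr_ge0 ?sqrB_ge0 // mulr_ge0.
Qed.

Lemma sqr_sum_ge (x0 x1 u0 u1 : C) : 0 <= x0 -> 0 <= x1 -> 0 <= u0 -> 0 <= u1 ->
  4%:R * (x0 * x1 * (u0 * u1)) <= (x0 * u0 + x1 * u1) * (x0 * u0 + x1 * u1).
Proof.
move=> x0p x1p u0p u1p; rewrite -subr_ge0.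
have -> : (x0 * u0 + x1 * u1) * (x0 * u0 + x1 * u1) - 4%:R * (x0 * x1 * (u0 * u1)) =
   (x0 * u0 - x1 * u1) ^+ 2 by ring.
by rewrite sqrB_ge0 // mulr_ge0.
Qed.

(* Multiplying the hypothesis by the adjugates of a and b expresses c through nu,
   up to the factor det2 a * det2 b. *)
Lemma kraus_weights_ge a b (c : 'I_2 -> 'I_2 * 'I_2 -> C) nu :
  (forall x y z, \sum_i \sum_j a x i * b y j * c z (i, j) =
     2%:R * nu * ((x == z) && (y == z))%:R) ->
  let g := \sum_z \sum_i \sum_j `|c z (i, j)| ^+ 2 in
  let x := rowsq a in let u := rowsq b in
  16%:R * `|nu| ^+ 2 <= g * (x 0 * u 0 + x 1 * u 1) /\
  16%:R * `|nu| ^+ 2 <= g * (x 0 * u 1 + x 1 * u 0).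
Proof.
move=> M g x u; pose D := `|det2 a| ^+ 2 * `|det2 b| ^+ 2.
have g_ge0 : 0 <= g.
  by do 3!(apply: sumr_ge0 => ? _); rewrite exprn_ge0.
have x_ge0 := rowsq_ge0 a; have u_ge0 := rowsq_ge0 b.
have adjE i j z : det2 a * det2 b * c z (i, j) = 2%:R * nu * adj2 a i z * adj2 b j z.
  transitivity (\sum_x \sum_y adj2 a i x * adj2 b j y *
      (2%:R * nu * ((x == z) && (y == z))%:R)); last first.
    rewrite (bigD1 z) //= [X in _ + X]big1 ?addr0; last first.
      by move=> x' /negbTE ->; rewrite big1 // => y' _; rewrite !mulr0.
    rewrite (bigD1 z) //= [X in _ + X]big1 ?addr0; last first.
      by move=> y' /negbTE ->; rewrite andbF !mulr0.
    by rewrite eqxx /= mulr1; ring.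
  under eq_bigr do under eq_bigr do rewrite -M.
  rewrite !sum_I2 /adj2 /det2.
  by move: i j; do 2!apply: forall_I2; rewrite !eqxx /= ?subr0 ?subrr; ring.
(* Column [z] of the adjugate of [a] has the norm of the other row of [a]; summing over [z] gives
   the agreement combination of row norms. *)
have DgE : D * g = 4%:R * `|nu| ^+ 2 * (x 0 * u 0 + x 1 * u 1).
  have gzE z : D * (\sum_i \sum_j `|c z (i, j)| ^+ 2) =
      4%:R * `|nu| ^+ 2 * ((\sum_i `|adj2 a i z| ^+ 2) * (\sum_j `|adj2 b j z| ^+ 2)).
    rewrite mulr_suml !mulr_sumr; apply: eq_bigr => i _.
    rewrite mulr_sumr mulr_sumr mulr_sumr; apply: eq_bigr => j _.
    by rewrite /D -!exprMn -!normrM adjE !normrM normr_nat; ring.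
  rewrite /g mulr_sumr; under eq_bigr do rewrite gzE.
  rewrite !sum_I2 /x /u /rowsq !sum_I2 /adj2 !eqxx /= !subr0 !subrr !normrN; ring.
have D_ge0 : 0 <= D by rewrite mulr_ge0 ?exprn_ge0.
have D_le : D <= x 0 * x 1 * (u 0 * u 1).
  by rewrite ler_pM ?exprn_ge0 ?det2_le.
have [->|nu_neq0] := eqVneq nu 0.
  by rewrite normr0 expr0n mulr0 !mulr_ge0 ?addr_ge0 ?mulr_ge0.
have nu2 : 0 < `|nu| ^+ 2 by rewrite exprn_gt0 ?normr_gt0.
(* If [D] vanished, [DgE] would make row 0 of [a] or of [b] zero, and then the hypothesis at
   [x = y = z = 0] would give [nu = 0]. *)
have D_gt0 : 0 < D.
  rewrite lt_neqAle D_ge0 andbT eq_sym; apply/eqP => D0.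
  move: DgE; rewrite D0 mul0r => /esym/eqP.
  have nu4 : 4%:R * `|nu| ^+ 2 != 0 by rewrite gt_eqF // mulr_gt0 // ltr0n.
  rewrite mulf_eq0 (negbTE nu4) orFb paddr_eq0 ?mulr_ge0 //.
  case/andP => /eqP xu0 _.
  have := M 0 0 0; rewrite !eqxx mulr1 => M0.
  suff : 2%:R * nu = 0 by move/eqP; rewrite mulf_eq0 pnatr_eq0 (negbTE nu_neq0).
  rewrite -M0 big1 // => i _; rewrite big1 // => j _.
  by move/eqP: xu0; rewrite mulf_eq0 => /orP[]/eqP/rowsq_eq0 ->; rewrite ?mulr0 ?mul0r.
(* After multiplication by [D], [DgE] replaces [D * g], and Hadamard's bound [D_le] on the left
   reduces the claim to [le_y]. *)
have main y : 4%:R * (x 0 * x 1 * (u 0 * u 1)) <= (x 0 * u 0 + x 1 * u 1) * y ->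
    16%:R * `|nu| ^+ 2 <= g * y.
  move=> le_y; rewrite -(ler_pM2l D_gt0) [leRHS]mulrA DgE.
  have -> : D * (16%:R * `|nu| ^+ 2) = 4%:R * `|nu| ^+ 2 * (4%:R * D) by ring.
  rewrite -[leRHS]mulrA ler_pM2l; last by rewrite mulr_gt0 // ltr0n.
  by apply: le_trans le_y; rewrite ler_pM2l ?ltr0n.
by split; apply: main; [apply: sqr_sum_ge|apply: mul_sums_ge].
Qed.

End Box.

(** * Output statistics of the box on the EPR pairs and on the maximally mixed state *)

Section BoxOutputs.
Variable R : realType.
Local Notation C := R[i].

Definition mixed4 : op R (('I_2 * 'I_2) * ('I_2 * 'I_2)) := (16%:R)^-1 *: 1%:M.

(** For a state, the probability that Alice's and Bob's computational-basis outcomes agree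
    ([y = true]) or differ ([y = false]), Charlie being traced out. *)
Definition agreement (X : op R (('I_2 * 'I_2) * 'I_2)) (y : bool) : C :=
  \sum_(p | (p.1.1 == p.1.2) == y) opget X p p.

Lemma sum_pair (A B : finType) (V : nmodType) (f : A * B -> V) :
  \sum_p f p = \sum_a \sum_b f (a, b).
Proof. by rewrite pair_bigA; apply: eq_bigr => -[]. Qed.

Lemma agreement_tr X : agreement X true + agreement X false = \tr X.
Proof.
rewrite opget_tr (bigID (fun p => p.1.1 == p.1.2)) /=; congr (_ + _).
  by apply: eq_bigl => p; rewrite eqb_id.
by apply: eq_bigl => p; rewrite eqbF_neg.
Qed.

Lemma vget_EPR (a b : 'I_2) : vget (EPR R) (a, b) = (sqrtC 2)^-1 * (a == b)%:R.
Proof.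
rewrite /vget /EPR !mxE !(inj_eq enum_rank_inj) !xpair_eqE; congr (_ * _).
by move: a b; do 2!apply: forall_I2; rewrite /= ?addr0 ?add0r.
Qed.

Lemma vget_EPR2 (a b c d : 'I_2) :
  vget (EPR_AC1_EPR_BC2 R) ((a, b), (c, d)) = 2%:R^-1 * ((a == c) && (b == d))%:R.
Proof.
rewrite /vget /EPR_AC1_EPR_BC2 mxE enum_rankK !vget_EPR -mulnb natrM.
have -> : 2%:R^-1 = (sqrtC 2)^-1 * (sqrtC 2)^-1 :> C by rewrite -invfM -expr2 sqrtCK.
by ring.
Qed.

Lemma vget_GHZ (x y z : 'I_2) :
  vget (GHZ R) ((x, y), z) = (sqrtC 2)^-1 * ((x == z) && (y == z))%:R.
Proof.
rewrite /vget /GHZ !mxE !(inj_eq enum_rank_inj) !xpair_eqE; congr (_ * _).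
by move: x y z; do 3!apply: forall_I2; rewrite /= ?addr0 ?add0r.
Qed.

Lemma opget_pure (I : finType) (v : vec R I) i j :
  opget (pure v) i j = vget v i * Num.conj (vget v j).
Proof. by rewrite /opget /pure mxE big_ord1 !mxE. Qed.

Definition kapp (I J : finType) (K : J -> I -> C) (v : vec R I) (p : J) : C :=
  \sum_i K p i * vget v i.

Lemma opget_kact_pure (I J : finType) (K : J -> I -> C) (v : vec R I) p q :
  opget (kact K (pure v)) p q = kapp K v p * Num.conj (kapp K v q).
Proof.
rewrite opgetE /kapp rmorph_sum mulr_suml; apply: eq_bigr => i _.
rewrite mulr_sumr; apply: eq_bigr => j _; rewrite opget_pure rmorphM /=; ring.
Qed.

(** The EPR pairs identify Alice's input with the first qubit of Charlie and Bob's with the second,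
    at amplitude 1/2. The contraction is thus half an entry of a c_z b^T, with c_z read as a
    two-by-two matrix. *)
Lemma kapp_EPR2
    (k : ('I_2 -> 'I_2 -> C) * ('I_2 -> 'I_2 -> C) * ('I_2 -> 'I_2 * 'I_2 -> C)) x y z :
  \sum_i \sum_j k.1.1 x i * k.1.2 y j * k.2 z (i, j) =
  2%:R * kapp (prodK k) (EPR_AC1_EPR_BC2 R) ((x, y), z).
Proof.
rewrite /kapp mulr_sumr sum_pair [RHS]sum_pair /=; apply: eq_bigr => a _.
apply: eq_bigr => b _; rewrite sum_pair (bigD1 a) //= (bigD1 b) //= vget_EPR2 !eqxx.
rewrite !big1 ?addr0 /prodK /=.
- by rewrite mulr1 mulrCA divff ?pnatr_eq0 // mulr1.
- move=> c /negbTE ca; rewrite big1 // => d _.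
  by rewrite vget_EPR2 eq_sym ca !mulr0.
- by move=> d /negbTE db; rewrite vget_EPR2 [b == _]eq_sym db andbF !mulr0.
Qed.

(** On a multiple of the identity, each diagonal output entry is a squared row norm of the product
    operator, hence a product of squared row norms of its factors. *)
Lemma agreement_kact_mixed4
    (k : ('I_2 -> 'I_2 -> C) * ('I_2 -> 'I_2 -> C) * ('I_2 -> 'I_2 * 'I_2 -> C)) y :
  let x := rowsq k.1.1 in let u := rowsq k.1.2 in
  agreement (kact (prodK k) mixed4) y =
  16%:R^-1 * ((\sum_z \sum_i \sum_j `|k.2 z (i, j)| ^+ 2) *
    (if y then x 0 * u 0 + x 1 * u 1 else x 0 * u 1 + x 1 * u 0)).
Proof.
move=> x u.
have entry a b z : opget (kact (prodK k) mixed4) ((a, b), z) ((a, b), z) =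
    16%:R^-1 * (x a * u b * \sum_i \sum_j `|k.2 z (i, j)| ^+ 2).
  rewrite opgetE.
  transitivity (\sum_i 16%:R^-1 * `|prodK k (a, b, z) i| ^+ 2).
    apply: eq_bigr => i _; rewrite (bigD1 i) //= big1 ?addr0 => [|j /negbTE ji].
      by rewrite /opget !mxE eqxx mulr1n normCK; ring.
    by rewrite /opget !mxE (inj_eq enum_rank_inj) eq_sym ji mulr0n !(mulr0, mul0r).
  rewrite -mulr_sumr; congr (_ * _).
  rewrite sum_pair sum_pair /= /x /u /rowsq.
  rewrite -mulrA mulr_suml; apply: eq_bigr => i _.
  rewrite mulr_suml mulr_sumr; apply: eq_bigr => j _.
  rewrite mulrA mulr_sumr sum_pair; apply: eq_bigr => c _.
  rewrite mulr_sumr; apply: eq_bigr => d _.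
  by rewrite /prodK /= !normrM !exprMn.
rewrite /agreement big_mkcond /= !sum_pair /= !sum_I2 /= !entry !sum_I2 /x /u.
by case: y => /=; rewrite ?add0r ?addr0; ring.
Qed.

Variable L : op R (('I_2 * 'I_2) * ('I_2 * 'I_2)) -> op R (('I_2 * 'I_2) * 'I_2).
Hypothesis boxL : is_2EPR_GHZ_box L.

Lemma vget_GHZ_neq (p : ('I_2 * 'I_2) * 'I_2) : p.1.1 != p.1.2 -> vget (GHZ R) p = 0.
Proof.
case: p => -[a b] c /= ab; rewrite vget_GHZ; case: eqP => [<-|_]; rewrite /= ?mulr0 //.
by rewrite eq_sym (negbTE ab) mulr0.
Qed.

Lemma agreement_EPR2_false : agreement (L (pure (EPR_AC1_EPR_BC2 R))) false = 0.
Proof.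
case: boxL => _ ->; rewrite /agreement big1 // => p; rewrite eqbF_neg => ab.
by rewrite opget_pure vget_GHZ_neq // mul0r.
Qed.

Lemma tr_EPR2 : \tr (pure (EPR_AC1_EPR_BC2 R)) = 1.
Proof.
rewrite opget_tr.
under eq_bigr do rewrite opget_pure -normCK.
rewrite !sum_pair; under eq_bigr do under eq_bigr do rewrite sum_pair.
rewrite !sum_I2 !vget_EPR2 /= !normrM !normr_nat normrV ?unitfE ?pnatr_eq0 // normr_nat.
by field.
Qed.

Lemma agreement_EPR2_true : agreement (L (pure (EPR_AC1_EPR_BC2 R))) true = 1.
Proof.
have := agreement_tr (L (pure (EPR_AC1_EPR_BC2 R))).
by rewrite agreement_EPR2_false addr0 (locc_trace _ boxL.1) tr_EPR2.
Qed.

Lemma tr_mixed4 : \tr mixed4 = 1.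
Proof.
rewrite opget_tr (eq_bigr (fun=> 16%:R^-1)).
  by rewrite sumr_const !card_prod card_ord -[_ *+ _]mulr_natr mulVf // pnatr_eq0.
by move=> i _; rewrite /opget !mxE eqxx mulr1n mulr1.
Qed.

Lemma agreement_sum (O : Type) (s : seq O) (X : O -> op R (('I_2 * 'I_2) * 'I_2)) y :
  agreement (\sum_(o <- s) X o) y = \sum_(o <- s) agreement (X o) y.
Proof.
rewrite /agreement [RHS]exchange_big /=.
by apply: eq_bigr => p _; rewrite opget_sum.
Qed.

Lemma agreement_mixed4_ge y : 2%:R^-1 <= agreement (L mixed4) y.
Proof.
have [s sE] := locc_separable boxL.1.
(* Indexing the Kraus operators by ordinals lets a vanishing sum of nonnegative terms be read off
   term by term. *)
pose k i := tnth (in_tuple s) i.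
have LE X : L X = \sum_i kact (prodK (k i)) X by rewrite sE big_tnth.
pose w i := kapp (prodK (k i)) (EPR_AC1_EPR_BC2 R).
have wE p q : \sum_i w i p * Num.conj (w i q) =
    vget (GHZ R) p * Num.conj (vget (GHZ R) q).
  rewrite -opget_pure -boxL.2 LE opget_sum.
  by apply: eq_bigr => i _; rewrite opget_kact_pure.
have w0 p : vget (GHZ R) p = 0 -> forall i, w i p = 0.
  move=> p0 i; have /eqP := wE p p; rewrite p0 mul0r.
  under eq_bigr do rewrite -normCK.
  rewrite psumr_eq0 => [/allP/(_ i)|j _]; last by rewrite exprn_ge0.
  by rewrite mem_index_enum expf_eq0 normr_eq0 /= => /(_ isT)/eqP.
(* The sum of |w i p - w i q|^2 expands into four products of GHZ amplitudes that cancel. With [w0],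
   this makes each [w i] a multiple of GHZ. *)
have wpq p q : vget (GHZ R) p = vget (GHZ R) q -> forall i, w i p = w i q.
  move=> pq i; apply/eqP; rewrite -subr_eq0.
  have : \sum_i `|w i p - w i q| ^+ 2 == 0.
    apply/eqP; transitivity (\sum_i (w i p * Num.conj (w i p) - w i p * Num.conj (w i q)
       - w i q * Num.conj (w i p) + w i q * Num.conj (w i q))).
      by apply: eq_bigr => j _; rewrite normCK rmorphB /=; ring.
    by rewrite !(big_split, sumrN) /= !wE pq; ring.
  rewrite psumr_eq0 => [/allP/(_ i)|j _]; last by rewrite exprn_ge0.
  by rewrite mem_index_enum expf_eq0 normr_eq0 /= => /(_ isT).
pose nu i := w i ((0, 0), 0).
have M i x y' z : \sum_a \sum_b (k i).1.1 x a * (k i).1.2 y' b * (k i).2 z (a, b) =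
    2%:R * nu i * ((x == z) && (y' == z))%:R.
  rewrite kapp_EPR2 -mulrA; congr (_ * _); rewrite -/(w i _).
  case: (boolP (_ && _)) => [/andP[/eqP -> /eqP ->]|xyz].
    by rewrite mulr1; apply: wpq; rewrite !vget_GHZ !eqxx.
  by rewrite mulr0; apply: w0; rewrite vget_GHZ (negbTE xyz) mulr0.
(* The value 1/2 is the squared GHZ amplitude at 000. *)
have nuE : \sum_i `|nu i| ^+ 2 = 2%:R^-1.
  under eq_bigr do rewrite normCK.
  rewrite wE vget_GHZ !eqxx mulr1 -normCK normrV ?unitfE ?sqrtC_eq0 ?pnatr_eq0 //.
  by rewrite ger0_norm ?sqrtC_ge0 ?ler0n // exprVn sqrtCK.
rewrite LE agreement_sum -nuE; apply: ler_sum => i _.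
rewrite agreement_kact_mixed4 -[leLHS](mulKf (_ : 16%:R != 0)) ?pnatr_eq0 //.
rewrite ler_pM2l ?invr_gt0 ?ltr0n //.
by have [] := kraus_weights_ge (M i); case: (y).
Qed.

Lemma agreement_mixed4 y : agreement (L mixed4) y = 2%:R^-1.
Proof.
have := agreement_tr (L mixed4); rewrite (locc_trace _ boxL.1) tr_mixed4 => E.
have E2 : agreement (L mixed4) y + agreement (L mixed4) (~~ y) = 1.
  by case: (y) => //=; rewrite addrC.
apply/le_anti; rewrite agreement_mixed4_ge andbT.
have -> : agreement (L mixed4) y = 1 - agreement (L mixed4) (~~ y) by rewrite -E2 addrK.
have -> : 2%:R^-1 = 1 - 2%:R^-1 :> C by field.
by rewrite lerD2l lerN2 agreement_mixed4_ge.
Qed.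

End BoxOutputs.

(** * Feinstein's lemma for a finite classical channel *)

Section Feinstein.
Variables (R : realType) (X Y : finType) (P : X -> R) (W : X -> Y -> R).
Hypothesis P_ge0 : forall x, 0 <= P x.
Hypothesis P_sum : \sum_x P x = 1.
Hypothesis W_ge0 : forall x y, 0 <= W x y.
Hypothesis W_sum : forall x, \sum_y W x y = 1.
Variables (theta eta eps : R).

Let Q y := \sum_x P x * W x y.

Hypothesis theta_ge0 : 0 <= theta.
(** Typicality of [y] for [x] means a likelihood ratio of [W x y] to [Q y] of at least 1/[theta]; it
    is required to be likely for every input [x], not only on average over [P]. *)
Hypothesis typical : forall x, \sum_(y | ~~ (Q y <= theta * W x y)) W x y <= eta.

(* Feinstein's maximal code construction: as long as the decoding sets have small
   Q-measure, some codeword has most of its typical outputs outside them. *)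
Lemma feinstein m : m%:R * theta < eps - eta + theta ->
  exists (cw : nat -> X) (B : nat -> {set Y}),
    [/\ forall i j, (i < j < m)%N -> [disjoint B i & B j],
        forall i y, (i < m)%N -> y \in B i -> Q y <= theta * W (cw i) y &
        forall i, (i < m)%N -> 1 - eps <= \sum_(y in B i) W (cw i) y].
Proof.
have /existsP [x0 _] : [exists x : X, true].
  apply/existsP; case: (pickP X) => [x _|X0]; first by exists x.
  by move: P_sum; rewrite big_pred0 // => /eqP; rewrite eq_sym oner_eq0.
have W_le1 x (A : {set Y}) : \sum_(y in A) W x y <= 1.
  by rewrite -(W_sum x) [leRHS](bigID (mem A)) /= lerDl sumr_ge0.
elim: m => [|m IH] mth.
  by exists (fun=> x0), (fun=> finset.set0); split=> // i j /andP[].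
(* The bound for m + 1 codewords leaves room for m earlier decoding sets, each of Q-measure at most
   [theta]. *)
have mth' : m%:R * theta < eps - eta by move: mth; rewrite -natr1 mulrDl mul1r ltrD2r.
have [|cw [B [disjB QB WB]]] := IH; first by apply: (lt_le_trans mth'); rewrite lerDl.
pose U : {set Y} := \bigcup_(i < m) B i.
have QU : \sum_(y in U) Q y < eps - eta.
  apply: le_lt_trans mth'.
  have Q_ge0 y : 0 <= Q y by apply: sumr_ge0 => x _; rewrite mulr_ge0.
  apply: (@le_trans _ _ (\sum_(i < m) \sum_(y in B i) Q y)).
    rewrite (exchange_big_dep (mem U)) /=; last first.
      by move=> i y _ yB; apply/bigcupP; exists i.
    apply: ler_sum => y /bigcupP[i _ yB].
    by rewrite (bigD1 i) //= lerDl sumr_ge0.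
  rewrite -[m in leRHS]card_ord mulr_natl -sumr_const; apply: ler_sum => i _.
  apply: (@le_trans _ _ (\sum_(y in B i) theta * W (cw i) y)).
    by apply: ler_sum => y yB; apply: QB.
  by rewrite -mulr_sumr ler_piMr.
(* [Q] is the [P]-average of the distributions [W x], so some [x] does at least as well as the
   average. *)
have [x xU] : exists x, \sum_(y in U) W x y < eps - eta.
  apply: contrapT => noX; move: QU; apply/negP; rewrite -leNgt.
  rewrite /Q exchange_big /= -[leLHS]mul1r -P_sum mulr_suml.
  apply: ler_sum => x _; rewrite -mulr_sumr ler_wpM2l // leNgt.
  by apply/negP => xU; apply: noX; exists x.
pose A : {set Y} := [set y | Q y <= theta * W x y] :\: U.
exists (fun i => if i == m then x else cw i), (fun i => if i == m then A else B i).
split=> [i j /andP[ij]|i y|i]; rewrite ltnS leq_eqVlt.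
- case/orP => [/eqP jm|jm].
    rewrite jm eqxx ltn_eqF -?jm //; rewrite disjoint_sym.
    apply/pred0P => y /=; rewrite !inE; apply/negbTE.
    apply/negP => /andP[/andP[yU _] yB]; case/negP: yU; apply/bigcupP.
    by rewrite jm in ij; exists (Ordinal ij).
  by rewrite !ltn_eqF // ?(ltn_trans ij) // disjB // ij.
- case/orP => [/eqP ->|im]; first by rewrite eqxx !inE => /andP[].
  by rewrite ltn_eqF //; apply: QB.
- case/orP => [/eqP ->|im]; last by rewrite ltn_eqF //; apply: WB.
  rewrite eqxx lerBlDr -(W_sum x) (bigID (mem A)) /= lerD2l.
  (* Outputs missed by [A] are atypical, at cost at most [eta], or lie in [U], at cost less than
     [eps - eta]. *)
  apply: (@le_trans _ _ (\sum_(y | ~~ (Q y <= theta * W x y)) W x y +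
      \sum_(y in U) W x y)).
    rewrite [X in X + _]big_mkcond [X in _ + X]big_mkcond -big_split big_mkcond /=.
    apply: ler_sum => y _; rewrite !inE.
    case: (Q y <= _); case: (y \in U); rewrite /= ?add0r ?addr0 ?lexx ?lerDl ?W_ge0 //.
  by move: (typical x) xU; lra.
Qed.

End Feinstein.

(** * Codes for the Z-channel at rate 0.3219 *)

Section ZChannel.
Variable R : realType.

(** The input [false] (EPR halves) always gives the output [true] (agreement); the input [true]
    (mixed state) gives a fair bit. *)
Definition zchan (x y : bool) : R := if x then 2%:R^-1 else y%:R.

Definition zprod n (x y : {ffun 'I_n -> bool}) : R := \prod_t zchan (x t) (y t).

(** The capacity-achieving input distribution, with output distribution [q]. The divergence of
    [zchan x] from [q] is log2 (5/4) for both inputs, so typicality will hold for every codeword. *)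
Let p (x : bool) : R := if x then 2%:R / 5%:R else 3%:R / 5%:R.
Let q (y : bool) : R := if y then 4%:R / 5%:R else 1 / 5%:R.

(* The log-likelihood ratio of zchan x and q, in bits, minus its mean log2 (5/4). *)
Let d (x y : bool) : R := if x then (if y then -1 else 1) else 0.

Lemma zchan_ge0 x y : 0 <= zchan x y.
Proof. by rewrite /zchan; case: x; rewrite ?invr_ge0 ?ler0n. Qed.

Lemma zchan_sum x : \sum_y zchan x y = 1.
Proof. by rewrite big_bool /zchan; case: x => /=; lra. Qed.

Lemma zprod_ge0 n (x y : {ffun 'I_n -> bool}) : 0 <= zprod x y.
Proof. by apply: prodr_ge0 => t _; apply: zchan_ge0. Qed.

Lemma zprod_sum n (x : {ffun 'I_n -> bool}) : \sum_y zprod x y = 1.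
Proof.
rewrite /zprod -(bigA_distr_bigA (fun t b => zchan (x t) b)) big1 // => t _.
exact: zchan_sum.
Qed.

Lemma zprod_output n (y : {ffun 'I_n -> bool}) :
  \sum_(x : {ffun 'I_n -> bool}) (\prod_t p (x t)) * zprod x y = \prod_t q (y t).
Proof.
transitivity (\sum_(x : {ffun 'I_n -> bool}) \prod_t (p (x t) * zchan (x t) (y t))).
  by apply: eq_bigr => x _; rewrite [RHS]big_split.
rewrite -(bigA_distr_bigA (fun t b => p b * zchan b (y t))).
by apply: eq_bigr => t _; rewrite big_bool /p /zchan /q; case: (y t) => /=; lra.
Qed.

(** The formula is checked letter by letter; a nonzero product rules out the letter pair [false],
    [false], the only one with transition probability 0. *)
Lemma zprod_likelihood n (x y : {ffun 'I_n -> bool}) : zprod x y != 0 ->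
  \prod_t q (y t) =
  (4%:R / 5%:R) ^+ n * zprod x y * 2 `^ (- \sum_t d (x t) (y t)).
Proof.
move=> W0.
have -> : 2 `^ (- \sum_t d (x t) (y t)) = \prod_t 2 `^ (- d (x t) (y t)).
  apply: (big_morph (fun r => 2 `^ (- r))) => [r s|]; last by rewrite oppr0 powRr0.
  by rewrite opprD powRD // pnatr_eq0 implybT.
have -> : (4%:R / 5%:R) ^+ n = \prod_(t < n) (4%:R / 5%:R : R).
  by rewrite prodr_const card_ord.
rewrite /zprod -!big_split /=; apply: eq_bigr => t _.
have : zchan (x t) (y t) != 0.
  apply: contraNneq W0 => t0; apply/eqP; rewrite /zprod (bigD1 t) //=.
  by rewrite t0 mul0r.
rewrite /zchan /q /d; case: (x t); case: (y t); rewrite ?eqxx //= => _.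
- by rewrite opprK powRr1 ?ler0n //; field.
- by rewrite powR_inv1 ?ler0n //; field.
- by rewrite oppr0 powRr0; field.
Qed.

(** Given [x], the summands are independent and centred, with variance 1 or 0 according to the input
    letter, so only the diagonal terms of the square survive. *)
Lemma zprod_second_moment n (x : {ffun 'I_n -> bool}) :
  \sum_y zprod x y * (\sum_t d (x t) (y t)) ^+ 2 <= n%:R.
Proof.
have corrE t u : \sum_y zprod x y * (d (x t) (y t) * d (x u) (y u)) =
    \prod_v \sum_b zchan (x v) b *
      ((if v == t then d (x v) b else 1) * (if v == u then d (x v) b else 1)).
  rewrite (bigA_distr_bigA (fun v b => zchan (x v) b *
    ((if v == t then d (x v) b else 1) * (if v == u then d (x v) b else 1)))) /=.
  apply: eq_bigr => y _; rewrite big_split big_split /=.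
  by rewrite -!big_mkcond !big_pred1_eq.
have corr_le t u :
    \sum_y zprod x y * (d (x t) (y t) * d (x u) (y u)) <= (t == u)%:R.
  rewrite corrE (bigD1 t) //= eqxx; have [<-|tu] := eqVneq t u.
    rewrite [X in _ * X]big1 ?mulr1 => [|v /negbTE ->]; last first.
      by under eq_bigr do rewrite mulr1 mulr1; rewrite zchan_sum.
    by rewrite big_bool /zchan /d; case: (x t) => /=; lra.
  (* For distinct positions the factor at [t] is the mean of [d], which is zero. *)
  rewrite big_bool /zchan /d.
  by case: (x t) => /=; rewrite (_ : _ + _ = 0) ?mul0r //; lra.
have -> : \sum_y zprod x y * (\sum_t d (x t) (y t)) ^+ 2 =
    \sum_t \sum_u \sum_y zprod x y * (d (x t) (y t) * d (x u) (y u)).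
  under [RHS]eq_bigr do rewrite exchange_big /=.
  rewrite [RHS]exchange_big /=; apply: eq_bigr => y _.
  rewrite expr2 mulr_suml mulr_sumr; apply: eq_bigr => t _.
  by rewrite mulr_sumr mulr_sumr.
apply: (@le_trans _ _ (\sum_(t < n) \sum_(u < n) (t == u)%:R)).
  by apply: ler_sum => t _; apply: ler_sum => u _; apply: corr_le.
rewrite -[n in leRHS]card_ord -sumr_const; apply: ler_sum => t _.
rewrite (bigD1 t) //= eqxx big1 ?addr0 // => u /negbTE.
by rewrite eq_sym => ->.
Qed.

(** Chebyshev's inequality: an atypical output of positive probability has a sum of [d] of at most
    -n delta, so its indicator is at most the square of that sum divided by (n delta)^2. *)
Lemma zprod_typical n (delta : R) (x : {ffun 'I_n -> bool}) :
  (0 < n)%N -> 0 < delta ->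
  \sum_(y : {ffun 'I_n -> bool} | ~~ (\prod_t q (y t) <=
      (4%:R / 5%:R) ^+ n * 2 `^ (n%:R * delta) * zprod x y)) zprod x y <=
    (n%:R * delta ^+ 2)^-1.
Proof.
move=> n_gt0 delta_gt0.
have nR : 0 < n%:R :> R by rewrite ltr0n.
rewrite big_mkcond /=.
apply: (@le_trans _ _ (\sum_y (n%:R * delta) ^- 2 *
    (zprod x y * (\sum_t d (x t) (y t)) ^+ 2))); last first.
  rewrite -mulr_sumr; apply: (@le_trans _ _ ((n%:R * delta) ^- 2 * n%:R)).
    by rewrite ler_wpM2l ?zprod_second_moment // invr_ge0 exprn_ge0 // mulr_ge0 // ltW.
  by rewrite le_eqVlt; apply/orP; left; apply/eqP; field; rewrite !gt_eqF.
apply: ler_sum => y _; case: ifP => [|_]; last first.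
  apply: mulr_ge0; first by rewrite invr_ge0 sqr_ge0.
  by apply: mulr_ge0; [exact: zprod_ge0|exact: sqr_ge0].
have [-> _|W0] := eqVneq (zprod x y) 0; first by rewrite mul0r mulr0.
rewrite (zprod_likelihood W0) => nle.
rewrite mulrCA ler_peMr ?zprod_ge0 //.
rewrite ler_pdivlMl ?mulr1; last by rewrite exprn_gt0 // mulr_gt0.
have Dle : n%:R * delta <= - \sum_t d (x t) (y t).
  rewrite leNgt; apply: contra nle => lt.
  rewrite mulrAC ler_wpM2r ?zprod_ge0 // ler_wpM2l ?exprn_ge0 //.
  by rewrite ler_powR ?ler1n // ltW.
by rewrite -[leRHS]sqrrN ler_sqr ?nnegrE ?(le_trans _ Dle) // mulr_ge0 // ltW.
Qed.

(* The capacity log2 (5/4) exceeds 47/146, which in turn exceeds 0.3219. *)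
Lemma capacity_gap : 4%:R / 5%:R * 2 `^ (47%:R / 146%:R) < 1 :> R.
Proof.
(* The 146th power turns the claim into the integer inequality 2^339 < 5^146; 47/146 is a continued
   fraction convergent of log2 (5/4) from below. *)
rewrite -(@ltr_pXn2r _ 146) ?nnegrE ?mulr_ge0 ?powR_ge0 //.
rewrite expr1n exprMn -(powR_mulrn 146 (powR_ge0 _ _)) -powRrM.
rewrite [X in 2 `^ X](_ : _ = 47%:R); last by field.
rewrite powR_mulrn // expr_div_n mulrAC ltr_pdivrMr ?mul1r ?exprn_gt0 //.
rewrite -!natrX -natrM ltr_nat.
by rewrite -[4%N]/(2 ^ 2)%N -expnM -expnD; lia.
Qed.

(** Feinstein's lemma is applied with [eta = eps / 2]. The number of codewords times [theta] is
    about [rho ^+ n], which tends to 0 by [capacity_gap]. *)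
Lemma zchan_code (eps : R) : 0 < eps ->
  exists n0 : nat, forall n : nat, (n0 <= n)%N ->
    exists (m : nat) (cw : 'I_m -> {ffun 'I_n -> bool})
        (dec : {ffun 'I_n -> bool} -> 'I_m),
      2 `^ (n%:R * (3219%:R / 10%:R ^+ 4)) <= m%:R :> R /\
      forall i, 1 - eps <= \sum_(y | dec y == i) zprod (cw i) y.
Proof.
move=> eps_gt0; pose r : R := 3219%:R / 10%:R ^+ 4.
pose delta : R := 47%:R / 146%:R - r.
have delta_gt0 : 0 < delta by rewrite /delta /r; lra.
pose rho : R := 4%:R / 5%:R * 2 `^ (47%:R / 146%:R).
have rho_ge0 : 0 <= rho by rewrite mulr_ge0 ?powR_ge0.
have rho_small : `|rho| < 1 by rewrite ger0_norm // capacity_gap.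
have /cvgrPdist_lt/(_ (eps / 2%:R)) := cvg_expr rho_small.
rewrite divr_gt0 // => /(_ isT)[n1 _ rhoP].
(* From [n2] on, the Chebyshev bound is at most [eps / 2]; the successor compensates for truncation
   and makes [n] positive. *)
pose n2 := (Num.truncn (2%:R / (eps * delta ^+ 2))).+1.
exists (maxn n1 n2) => n; rewrite geq_max => /andP[n1n n2n].
have n_gt0 : (0 < n)%N by apply: leq_trans n2n.
have rho_n : rho ^+ n < eps / 2%:R.
  by have := rhoP n n1n; rewrite /= sub0r normrN ger0_norm // exprn_ge0.
pose theta : R := (4%:R / 5%:R) ^+ n * 2 `^ (n%:R * delta).
have theta_ge0 : 0 <= theta by rewrite mulr_ge0 ?exprn_ge0 ?powR_ge0.
have rate_theta : 2 `^ (n%:R * r) * theta = rho ^+ n.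
  rewrite /theta mulrCA -powRD ?pnatr_eq0 ?implybT // -mulrDr.
  have -> : r + delta = 47%:R / 146%:R by rewrite /delta; ring.
  by rewrite [n%:R * _]mulrC powRrM powR_mulrn ?powR_ge0 // -exprMn.
pose k := Num.truncn (2 `^ (n%:R * r)).
have /andP[k_le k_gt] := truncn_itv (powR_ge0 2 (n%:R * r)).
have eta_le : (n%:R * delta ^+ 2)^-1 <= eps / 2%:R.
  have : 2%:R / (eps * delta ^+ 2) <= n%:R.
    have ge0 : 0 <= 2%:R / (eps * delta ^+ 2).
      by rewrite ltW // divr_gt0 // mulr_gt0 // exprn_gt0.
    have /andP[_ /ltW lt] := truncn_itv ge0.
    by apply: le_trans lt _; rewrite ler_nat.
  have d2 : 0 < delta ^+ 2 by rewrite exprn_gt0.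
  rewrite ler_pdivrMr ?mulr_gt0 // => le2.
  rewrite -div1r ler_pdivrMr ?mulr_gt0 ?ltr0n //.
  by move: le2; lra.
have P_sum : \sum_(x : {ffun 'I_n -> bool}) \prod_t p (x t) = 1.
  rewrite -(bigA_distr_bigA (fun=> p)) big1 // => t _.
  by rewrite big_bool /p /=; lra.
have P_ge0 (x : {ffun 'I_n -> bool}) : 0 <= \prod_t p (x t).
  by apply: prodr_ge0 => t _; rewrite /p; case: (x t); lra.
have typ (x : {ffun 'I_n -> bool}) :
    \sum_(y | ~~ (\sum_(u : {ffun 'I_n -> bool}) (\prod_t p (u t)) * zprod u y <=
        theta * zprod x y))
      zprod x y <= eps / 2%:R.
  apply: le_trans eta_le; under eq_bigl do rewrite zprod_output.
  exact: zprod_typical.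
(* The extra codeword that rounds the rate up is paid for by the spare [theta] in Feinstein's
   condition. *)
have k_theta : k.+1%:R * theta < eps - eps / 2%:R + theta.
  rewrite -natr1 mulrDl mul1r ltrD2r.
  apply: (@le_lt_trans _ _ (rho ^+ n)); last by move: rho_n; lra.
  by rewrite -rate_theta ler_wpM2r.
have [cw [B [disjB _ WB]]] := feinstein P_ge0 P_sum (@zprod_ge0 n) (@zprod_sum n)
  theta_ge0 typ k_theta.
(* Outputs outside all decoding sets are decoded as message 0; disjointness makes the choice
   unambiguous elsewhere. *)
exists k.+1, (fun i => cw i), (fun y => odflt ord0 [pick i : 'I_k.+1 | y \in B i]).
split=> [|i]; first exact: ltW.
apply: le_trans (WB i (ltn_ord i)) _.
rewrite [leLHS]big_mkcond [leRHS]big_mkcond; apply: ler_sum => y _.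
case: ifP => yB; last by case: ifP => // _; apply: zprod_ge0.
case: pickP => [j /= yBj|/(_ i)]; last by rewrite yB.
suff -> : j = i by rewrite eqxx.
apply/val_inj; case: (ltngtP j i) => // ij.
  have /disjointFr/(_ yBj) := disjB j i (introT andP (conj ij (ltn_ord i))).
  by rewrite yB.
have /disjointFr/(_ yB) := disjB i j (introT andP (conj ij (ltn_ord j))).
by rewrite yBj.
Qed.

End ZChannel.

(** * Constructions that preserve positivity *)

Section PsdConstructions.
Variable R : realType.
Implicit Types I J K : finType.

Lemma psd_of_sum_pure I (T : Type) (s : seq T) (v : T -> I -> R[i]) (X : op R I) :
  (forall i j, opget X i j = \sum_(t <- s) v t i * Num.conj (v t j)) -> psd X.
Proof.
move=> XE; apply/psdE => f.
have -> : \sum_i \sum_j Num.conj (f i) * opget X i j * f j =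
    \sum_(t <- s) `|\sum_i v t i * Num.conj (f i)| ^+ 2.
  transitivity (\sum_(t <- s) \sum_i \sum_j
      Num.conj (f i) * (v t i * Num.conj (v t j)) * f j).
    rewrite [RHS]exchange_big /=; apply: eq_bigr => i _.
    rewrite [RHS]exchange_big /=; apply: eq_bigr => j _.
    by rewrite XE mulr_sumr mulr_suml.
  apply: eq_bigr => t _; rewrite normCK rmorph_sum mulr_suml.
  apply: eq_bigr => i _; rewrite mulr_sumr; apply: eq_bigr => j _.
  by rewrite rmorphM /= conjCK; ring.
by apply: sumr_ge0 => t _; rewrite exprn_ge0.
Qed.

Lemma psd_diag I (b : pred I) : psd (mkop (fun i j => ((i == j) && b i)%:R) : op R I).
Proof.
apply: (@psd_of_sum_pure _ I (index_enum I) (fun t i => ((i == t) && b i)%:R)) => i j.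
rewrite opgetE (bigD1 i) //= big1 ?addr0 => [|t /negbTE ti].
  rewrite eqxx conjC_nat -natrM mulnb eq_sym /=.
  by case: eqP => [->|]; rewrite ?andbb ?andbF.
by rewrite eq_sym ti mul0r.
Qed.

(** A pure summand composed with [h o] is pure again. This covers both regrouping of factors and
    partial traces. *)
Lemma psd_sum_relabel I J (O : finType) (h : O -> J -> I) (X : op R I) :
  psd X -> psd (mkop (fun i j => \sum_o opget X (h o i) (h o j)) : op R J).
Proof.
move=> /psd_sum_pure[s sE].
apply: (@psd_of_sum_pure _ _ [seq (o, v) | o <- enum O, v <- s]
  (fun ov i => ov.2 (h ov.1 i))) => i j.
by rewrite opgetE big_allpairs big_enum /=; apply: eq_bigr => o _; rewrite sE.
Qed.

(** Expanding the product of sums gives product vectors, indexed by a choice [k] of one pure summand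
    per factor. *)
Lemma psd_tensor_power I n (X : op R I) :
  psd X -> psd (mkop (fun f g : {ffun 'I_n -> I} => \prod_t opget X (f t) (g t))).
Proof.
move=> /psd_sum_pure[s sE].
pose v (k : {ffun 'I_n -> 'I_(size s)}) (f : {ffun 'I_n -> I}) :=
  \prod_t tnth (in_tuple s) (k t) (f t).
apply: (psd_of_sum_pure (s := index_enum _) (v := v)) => f g.
rewrite opgetE; under eq_bigr do rewrite sE big_tnth.
rewrite bigA_distr_bigA /=; apply: eq_bigr => k _.
by rewrite rmorph_prod -big_split.
Qed.

Lemma tr_mulmx I (A B : op R I) :
  \tr (A *m B) = \sum_i \sum_j opget A i j * opget B j i.
Proof.
rewrite /mxtrace sum_enum_val; apply: eq_bigr => i _.
by rewrite mxE sum_enum_val.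
Qed.

Lemma bigA_distr_pair n (S T : finType) (F : 'I_n -> S * T -> R[i]) :
  \sum_(i : {ffun 'I_n -> S} * {ffun 'I_n -> T}) \prod_t F t (i.1 t, i.2 t) =
  \prod_t \sum_p F t p.
Proof.
under [RHS]eq_bigr do rewrite sum_pair.
rewrite bigA_distr_bigA sum_pair; apply: eq_bigr => f _ /=.
by rewrite bigA_distr_bigA.
Qed.

End PsdConstructions.

(** * Turning a binary classical code into a quantum code for the box *)

Section BinaryCode.
Variables (R : realType) (S T S' T' : finType).
Variable L : op R (S * T) -> op R (S' * T').
Hypothesis linL : linear L.
Variables (sigma : op R (S * (T * T))) (ev : S' -> bool).
Hypothesis sigmaP : density sigma.

(* Charlie holds two candidate inputs for each box, and a bit selects the one that
   he feeds into it. *)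
Definition select (b : bool) (t r : T) : T * T := if b then (r, t) else (t, r).

(** The input state of one box after Charlie's choice; [r] runs over the rejected candidate, which
    is traced out. *)
Definition selected (b : bool) : op R (S * T) :=
  mkop (fun p q => \sum_r opget sigma (p.1, select b p.2 r) (q.1, select b q.2 r)).

(** The transition probability of the induced classical channel: Alice and Bob measure in the
    computational basis and keep only [ev] of the outcome. *)
Definition event_weight (b y : bool) : R[i] :=
  \sum_(s | ev s == y) \sum_z opget (L (selected b)) (s, z) (s, z).

Variables (n m : nat) (cw : 'I_m -> {ffun 'I_n -> bool}).
Variable dec : {ffun 'I_n -> bool} -> 'I_m.

Definition selectn (b : {ffun 'I_n -> bool}) (r k : {ffun 'I_n -> T}) :
  {ffun 'I_n -> T * T} := [ffun t => select (b t) (k t) (r t)].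

(** The n copies of [sigma], regrouped by party; the factor [unit] says that Alice and Bob keep
    nothing besides their box inputs. *)
Definition box_shared : op R (unit * ({ffun 'I_n -> S} * {ffun 'I_n -> T * T})) :=
  mkop (fun p q : unit * ({ffun 'I_n -> S} * {ffun 'I_n -> T * T}) =>
    \prod_t opget sigma (p.2.1 t, p.2.2 t) (q.2.1 t, q.2.2 t)).

Definition box_encoder (o : 'I_m) (X : op R {ffun 'I_n -> T * T}) :
    op R {ffun 'I_n -> T} :=
  mkop (fun k l => \sum_r opget X (selectn (cw o) r k) (selectn (cw o) r l)).

Definition events (k : {ffun 'I_n -> S'}) : {ffun 'I_n -> bool} := [ffun t => ev (k t)].

Definition box_decoder (o : 'I_m) : op R (unit * {ffun 'I_n -> S'}) :=
  mkop (fun p q => ((p == q) && (dec (events p.2) == o))%:R).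

Lemma box_sharedP : density box_shared.
Proof.
case: sigmaP => psd_sigma tr_sigma; split.
  pose h (_ : unit) (p : unit * ({ffun 'I_n -> S} * {ffun 'I_n -> T * T})) :=
    [ffun t => (p.2.1 t, p.2.2 t)].
  have := psd_sum_relabel h (psd_tensor_power (n := n) psd_sigma).
  congr psd; apply: op_ext => p q; rewrite !opgetE (big_pred1 tt) ?opgetE; last by case.
  by apply: eq_bigr => t _; rewrite !ffunE.
rewrite opget_tr sum_pair (big_pred1 tt) /=; last by case.
under eq_bigr do rewrite opgetE /=.
rewrite (bigA_distr_pair (fun _ p => opget sigma p p)).
by rewrite -opget_tr tr_sigma big1.
Qed.

(** Makes the encoder trace preserving: it permutes Charlie's basis and then takes a partial
    trace. *)
Lemma selectn_bij b : bijective (fun p : {ffun 'I_n -> T} * {ffun 'I_n -> T} =>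
  selectn b p.1 p.2).
Proof.
exists (fun u : {ffun 'I_n -> T * T} => ([ffun t => if b t then (u t).1 else (u t).2],
                  [ffun t => if b t then (u t).2 else (u t).1])).
  by case=> r k; congr pair; apply/ffunP => t; rewrite !ffunE /select; case: (b t).
by move=> u; apply/ffunP => t; rewrite !ffunE /select; case: (b t); case: (u t).
Qed.

Lemma box_encoderP o : channel (box_encoder o).
Proof.
split; first split.
- move=> c X Y; apply: op_ext => k l; rewrite opgetD opgetZ !opgetE mulr_sumr -big_split.
  by apply: eq_bigr => r _; rewrite opgetD opgetZ.
- move=> K X psdX.
  have := psd_sum_relabel (fun r (p : K * {ffun 'I_n -> T}) =>
    (p.1, selectn (cw o) r p.2)) psdX.
  congr psd; apply: op_ext => p q; rewrite !opgetE.
  by apply: eq_bigr => r _; rewrite opgetE.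
move=> X; rewrite !opget_tr; under eq_bigr do rewrite opgetE.
rewrite exchange_big /= pair_bigA /=.
by rewrite [RHS](reindex _ (onW_bij _ (selectn_bij (cw o)))).
Qed.

Lemma box_decoderP : povm box_decoder.
Proof.
split=> [x|]; first exact: psd_diag.
apply: op_ext => p q; rewrite opget_sum.
under eq_bigr do rewrite opgetE.
rewrite [RHS]mxE (inj_eq enum_rank_inj) (bigD1 (dec (events p.2))) //= eqxx andbT.
by rewrite big1 ?addr0 // => o /negbTE; rewrite eq_sym => ->; rewrite andbF.
Qed.

Definition box_code : cv_code R S T S' n m :=
  CVCode box_sharedP box_encoderP box_decoderP.

Lemma selectedn o (i j : {ffun 'I_n -> S} * {ffun 'I_n -> T}) :
  opget (ampl (box_encoder o) (mkop (fun p q => opget box_shared (tt, p) (tt, q)))) i j =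
  \prod_t opget (selected (cw o t)) (i.1 t, i.2 t) (j.1 t, j.2 t).
Proof.
rewrite !opgetE.
under [RHS]eq_bigr do rewrite opgetE.
rewrite bigA_distr_bigA /=; apply: eq_bigr => r _; rewrite !opgetE.
by apply: eq_bigr => t _; rewrite /= !ffunE.
Qed.

(** The encoded state is a product over the uses, so the sums defining [boxes] factor, and linearity
    of [L] reassembles its output in each factor. *)
Lemma boxes_selected o (k : {ffun 'I_n -> S'}) :
  opget (received L box_code o) (tt, k) (tt, k) =
  \prod_t \sum_z opget (L (selected (cw o t))) (k t, z) (k t, z).
Proof.
rewrite !opgetE /=; under eq_bigr do rewrite opgetE /=.
under eq_bigr do under eq_bigr do under eq_bigr do rewrite selectedn -big_split /=.
rewrite bigA_distr_bigA /=; apply: eq_bigr => z _.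
under eq_bigr do rewrite (bigA_distr_pair (fun t q =>
  opget (selected (cw o t)) (_, _) q *
  opget (L (ketbra R (_, _) q)) (k t, z t) (k t, z t))).
rewrite (bigA_distr_pair (fun t p => \sum_q opget (selected (cw o t)) p q *
  opget (L (ketbra R p q)) (k t, z t) (k t, z t))).
apply: eq_bigr => t _; rewrite (linear_ketbra _ linL) opget_sum.
apply: eq_bigr => p _; rewrite opget_sum; apply: eq_bigr => q _.
by rewrite opgetZ.
Qed.

(** The code thus sees a memoryless classical channel with transition weights [event_weight]. *)
Lemma box_code_success o :
  success_prob L box_code o =
  \sum_(y | dec y == o) \prod_t event_weight (cw o t) (y t).
Proof.
rewrite /success_prob tr_mulmx.
transitivity (\sum_p (dec (events p.2) == o)%:R * opget (received L box_code o) p p).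
  apply: eq_bigr => p _; rewrite (bigD1 p) //= [X in _ + X]big1 ?addr0.
    by rewrite opgetE eqxx.
  by move=> q /negbTE qp; rewrite opgetE eq_sym qp mul0r.
rewrite sum_pair (big_pred1 tt) /=; last by case.
under eq_bigr do rewrite boxes_selected.
rewrite (partition_big events predT) //= [RHS]big_mkcond /=; apply: eq_bigr => y _.
case: ifP => dy; last first.
  by rewrite big1 // => k /eqP ->; rewrite dy mul0r.
transitivity (\sum_(k | events k == y) \prod_t \sum_z
    opget (L (selected (cw o t))) (k t, z) (k t, z)).
  by apply: eq_bigr => k /eqP ->; rewrite dy mul1r.
rewrite /event_weight bigA_distr_big_dep; apply: eq_bigl => k.
apply/eqP/familyP => [<- t|kP]; first by rewrite unfold_in /= ffunE.
by apply/ffunP => t; rewrite ffunE; apply/eqP/kP.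
Qed.

End BinaryCode.

(** * The 2EPR-GHZ box as a Z-channel, and the resulting bound *)

Section BoxCode.
Variable R : realType.

Lemma separable_linear (A B C A' B' C' : finType)
    (L : op R ((A * B) * C) -> op R ((A' * B') * C')) : separable L -> linear L.
Proof.
case=> s sE c X Y; rewrite !sE scaler_sumr -big_split /=; apply: eq_bigr => k _.
apply: op_ext => p q; rewrite opgetD opgetZ !opgetE mulr_sumr -big_split /=.
apply: eq_bigr => i _; rewrite mulr_sumr -big_split /=; apply: eq_bigr => j _.
by rewrite opgetD opgetZ; ring.
Qed.

Lemma opget_pure_EPR2 (s t s' t' : 'I_2 * 'I_2) :
  opget (pure (EPR_AC1_EPR_BC2 R)) (s, t) (s', t') =
  4%:R^-1 * ((s == t)%:R * (s' == t')%:R).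
Proof.
case: s t s' t' => [a b] [c d] [a' b'] [c' d'].
rewrite opget_pure !vget_EPR2 rmorphM /= fmorphV !conjC_nat !xpair_eqE.
by field.
Qed.

(** Charlie's first candidate is his halves of the EPR pairs; the second is an uncorrelated
    maximally mixed state. *)
Definition EPR2_junk : op R (('I_2 * 'I_2) * (('I_2 * 'I_2) * ('I_2 * 'I_2))) :=
  mkop (fun p q => 4%:R^-1 * (p.2.2 == q.2.2)%:R *
    opget (pure (EPR_AC1_EPR_BC2 R)) (p.1, p.2.1) (q.1, q.2.1)).

Lemma sum_const_I2I2 (x : R[i]) : \sum_(s : 'I_2 * 'I_2) x = 4%:R * x.
Proof. by rewrite sumr_const card_prod card_ord mulr_natl. Qed.

Lemma EPR2_junkP : density EPR2_junk.
Proof.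
split.
  (* One vector per basis state of the mixed candidate; 1/4 is the EPR amplitude 1/2 times the
     square root of the weight 1/4. *)
  pose v (r : 'I_2 * 'I_2) (p : ('I_2 * 'I_2) * (('I_2 * 'I_2) * ('I_2 * 'I_2))) : R[i] :=
    4%:R^-1 * ((r == p.2.2)%:R * (p.1 == p.2.1)%:R).
  apply: (psd_of_sum_pure (s := index_enum _) (v := v)) => p q.
  rewrite opgetE (bigD1 p.2.2) //= big1 ?addr0 => [|r /negbTE rp]; last first.
    by rewrite /v rp mul0r mulr0 mul0r.
  rewrite /v opget_pure_EPR2 eqxx !rmorphM /= fmorphV !conjC_nat.
  by field.
rewrite opget_tr sum_pair; under eq_bigr do rewrite sum_pair.
transitivity (\sum_(s : 'I_2 * 'I_2) (4%:R^-1 : R[i])).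
  apply: eq_bigr => s _; rewrite (bigD1 s) //= [X in _ + X]big1 ?addr0.
    under eq_bigr do rewrite opgetE /= opget_pure_EPR2 !eqxx.
    by rewrite sum_const_I2I2 /=; field.
  move=> t /negbTE ts; rewrite big1 // => r _.
  by rewrite opgetE /= opget_pure_EPR2 eq_sym ts mul0r !mulr0.
by rewrite sum_const_I2I2 divff // pnatr_eq0.
Qed.

Lemma selected_false : selected EPR2_junk false = pure (EPR_AC1_EPR_BC2 R).
Proof.
apply: op_ext => -[s t] [s' t']; rewrite opgetE /=.
under eq_bigr do rewrite opgetE /= eqxx.
by rewrite sum_const_I2I2 /=; field.
Qed.

(** Tracing out the EPR halves leaves Alice and Bob maximally mixed and uncorrelated with the other
    candidate. *)
Lemma selected_true : selected EPR2_junk true = mixed4 R.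
Proof.
apply: op_ext => -[s t] [s' t']; rewrite opgetE /=.
under eq_bigr do rewrite opgetE /= opget_pure_EPR2.
rewrite /mixed4 opgetZ [opget 1%:M _ _]mxE (inj_eq enum_rank_inj) xpair_eqE.
rewrite (bigD1 s) //= [X in _ + X]big1 ?addr0; last first.
  by move=> r /negbTE; rewrite eq_sym => ->; rewrite mul0r !mulr0.
rewrite eqxx [s' == s]eq_sym.
by case: (s == s'); case: (t == t') => /=; field.
Qed.

Variable L : op R (('I_2 * 'I_2) * ('I_2 * 'I_2)) -> op R (('I_2 * 'I_2) * 'I_2).
Hypothesis boxL : is_2EPR_GHZ_box L.

Lemma event_weight_zchan b y :
  event_weight L EPR2_junk (fun s => s.1 == s.2) b y = (zchan R b y)%:C%C.
Proof.
transitivity (agreement (L (selected EPR2_junk b)) y).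
  rewrite /agreement /event_weight [LHS]big_mkcond [RHS]big_mkcond [RHS]sum_pair /=.
  by apply: eq_bigr => s _; case: ifP => // _; rewrite big1.
rewrite /zchan; case: b.
  by rewrite selected_true agreement_mixed4 // fmorphV rmorph_nat.
rewrite selected_false; case: y.
  by rewrite agreement_EPR2_true.
by rewrite agreement_EPR2_false.
Qed.

Lemma achievable_3219 : achievable L (3219%:R / 10%:R ^+ 4).
Proof.
split=> [|eps /zchan_code[n0 n0P]].
  exact: divr_ge0 (ler0n _ _) (exprn_ge0 _ (ler0n _ _)).
exists n0 => n /n0P[m [cw [dec [m_ge cwP]]]].
exists m, (box_code (fun s : 'I_2 * 'I_2 => s.1 == s.2) EPR2_junkP cw dec).
split=> [|x]; first exact: m_ge.
rewrite box_code_success; last first.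
  exact/separable_linear/locc_separable/boxL.1.
apply: (@le_trans _ _ (\sum_(y | dec y == x) zprod R (cw x) y)%:C%C).
  by rewrite lecR.
rewrite rmorph_sum; apply: ler_sum => y _.
rewrite rmorph_prod; under [leRHS]eq_bigr do rewrite event_weight_zchan.
exact: lexx.
Qed.

End BoxCode.

Theorem theorem5 (R : realType)
  (L : op R (('I_2 * 'I_2) * ('I_2 * 'I_2)) -> op R (('I_2 * 'I_2) * 'I_2)) :
  is_2EPR_GHZ_box L ->
  (0 < CV L)%E /\ ((3219%:R / 10%:R ^+ 4)%R%:E <= CV L)%E.
Proof.
move=> boxL.
have CV_ge : ((3219%:R / 10%:R ^+ 4)%R%:E <= CV L)%E.
  apply: ereal_sup_ubound; exists (3219%:R / 10%:R ^+ 4) => [|//].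
  exact: achievable_3219.
split=> //; apply: lt_le_trans CV_ge.
by rewrite lte_fin divr_gt0 ?exprn_gt0 ?ltr0n.
Qed.
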